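(* Let $n\ge 6$ with $n\equiv 2\pmod 4$, and consider the cycle graph $C_n$ with its eigenspaces in frequency order, where the tie for last place is between the eigenspaces $\Lambda_{(n-2)/4}$ and $\Lambda_{(n+2)/4}$. Then every minimal (weighted) extremal design of $C_n$ consists of $n-4$ or $n-2$ vertices, depending on which of these two eigenspaces is ordered last; that is, for one of the two choices of last eigenspace every minimal extremal design has exactly $n-4$ vertices, and for the other choice every minimal extremal design has exactly $n-2$ vertices.
   Context: $C_n$ is the cycle graph on $n$ vertices. Eigenvalues and eigenspaces of $C_n$ are those of $\frac12A$, with $A$ the adjacency matrix. For $1\le j\le\lfloor (n-1)/2\rfloor$, $\Lambda_j$ denotes here the two-dimensional eigenspace with eigenvalue $\cos(2\pi j/n)$, spanned by $(\cos(2\pi jv/n))_{v}$ and $(\sin(2\pi jv/n))_{v}$, $v=0,\dots,n-1$. The remaining eigenspaces are $\operatorname{span}\{\mathbb{1}\}$ (eigenvalue $1$) and, for even $n$, the one-dimensional eigenspace of $-1$. Frequency order means that eigenspaces are ordered by decreasing absolute value of the eigenvalue, with $\operatorname{span}\{\mathbb{1}\}$ first and ties broken by choice. A vertex subset $W$ with real weights $(a_w)_{w\in W}$ averages an eigenspace $\Lambda$ if $\sum_{w\in W}a_w\phi(w)=\frac1n\sum_{v}\phi(v)$ for all $\phi\in\Lambda$. $W$ is a (weighted) extremal design if there are weights $a_w\in\mathbb{R}$ with which $W$ averages all eigenspaces except the last one. Minimal means inclusion-minimal among weighted extremal designs. *)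

(* Defs.v *)
From HB Require Import structures.
From mathcomp Require Import all_boot all_order all_algebra.
From mathcomp Require Import all_classical all_reals all_analysis.

Set Implicit Arguments.
Unset Strict Implicit.
Unset Printing Implicit Defensive.

Import Order.TTheory GRing.Theory Num.Theory.
Local Open Scope ring_scope.

Definition cycle_adj (n : nat) : rel 'I_n :=
  fun u v => (v == ordS u) || (u == ordS v).

Definition cycle_op (R : realType) (n : nat) : 'M[R]_n :=
  2^-1 *: \matrix_(u, v) (cycle_adj u v)%:R.

(* Functions on the vertices are row vectors and eigenspaces are row spaces,
   as in mxalgebra; [cycle_op R n] is symmetric, so row and column eigenvectors
   agree. *)
Definition Lambda (R : realType) (n j : nat) : 'M[R]_n :=
  eigenspace (cycle_op R n) (cos (2 * pi * j%:R / n%:R)).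

Section Designs.
Variables (R : realType) (n : nat) (M : 'M[R]_n).

(* An ordering of the eigenspaces is given as a list of the distinct
   eigenvalues, each standing for its eigenspace. *)
Definition frequency_order (s : seq R) : Prop :=
  [/\ uniq s,
      forall x, (x \in s) = eigenvalue M x,
      (eigenspace M (head 0 s) == (const_mx 1 : 'rV[R]_n))%MS
    & sorted (fun x y => `|y| <= `|x|) s].

(* The defaults of [head] above and of [last] here are irrelevant as soon as
   [M] has an eigenvalue. *)
Definition last_eigenspace (s : seq R) : 'M[R]_n := eigenspace M (last 0 s).

Definition averages (W : {set 'I_n}) (a : 'I_n -> R) (L : 'M[R]_n) : Prop :=
  forall phi : 'rV[R]_n, (phi <= L)%MS ->
    \sum_(w in W) a w * phi ord0 w = n%:R^-1 * \sum_v phi ord0 v.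

(* Only the values of [a] on [W] matter. *)
Definition extremal_design (s : seq R) (W : {set 'I_n}) : Prop :=
  exists a : 'I_n -> R,
    forall x, x \in s -> x != last 0 s -> averages W a (eigenspace M x).

Definition minimal_extremal_design (s : seq R) (W : {set 'I_n}) : Prop :=
  extremal_design s W /\
  forall W' : {set 'I_n}, W' \subset W -> extremal_design s W' -> W' = W.

End Designs.

Definition minimal_designs_have_card (R : realType) (n j k : nat) : Prop :=
  forall s : seq R, frequency_order (cycle_op R n) s ->
    (last_eigenspace (cycle_op R n) s == Lambda R n j)%MS ->
  forall W : {set 'I_n}, minimal_extremal_design (cycle_op R n) s W ->
    #|W| = k.

(* Main.v *)
Require Import Defs.
From HB Require Import structures.
From mathcomp Require Import all_boot all_order all_algebra.
From mathcomp Require Import all_classical all_reals all_analysis.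
From mathcomp Require Import ring lra zify.

(** Write [n = 2 m] with [m] odd. If weights [a] on [W] average every eigenspace
    but the last one, then [a], extended by zero, minus the constant [1/n] is
    orthogonal to all these eigenspaces, hence lies in the last one: [W] is an
    extremal design exactly when some function of the last eigenspace equals 1
    on the whole complement of [W] ([extremal_designP]). Orthogonality of the
    eigenspaces comes from the symmetry of the operator, and completeness from
    the real discrete Fourier transform ([fourier_inversion]).

    The functions of [Lambda j] are [v |-> x cos (2 pi j v / n) +
    y sin (2 pi j v / n)], that is, linear forms on the plane evaluated at the
    points [circle_pt j v] of the unit circle. A level set at 1 consists of the
    vertices whose point lies on a given line, and a line meets the circle in at
    most two points ([unit_circle_line]). Conversely a level set with at most one
    point can be enlarged to one with two points ([level_extension]). So the
    complements of the minimal designs are unions of two fibers of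
    [circle_pt j], and it remains to count a fiber: both candidates for [j] are
    coprime to [m], so fibers are singletons for odd [j] and pairs
    [{u, u + m}] for even [j]. The candidates [(m - 1) / 2] and [(m + 1) / 2] are
    consecutive integers, so one is odd and the other even; this gives [n - 2]
    and [n - 4].

    That exactly these two frequencies may come last is the fact that
    [|cos (pi k / m)|] is least when [k / m] is nearest to [1/2]
    ([norm_cosn_min]), the two eigenvalues being opposite to each other and
    nonzero. *)

Set Implicit Arguments.
Unset Strict Implicit.
Unset Printing Implicit Defensive.

Import Order.TTheory GRing.Theory Num.Theory.
Local Open Scope ring_scope.

(** * Sines and cosines of rational angles *)

Section RootsOfUnity.
Variables (R : realType) (n : nat).

(** [cosn d] and [sinn d] are the coordinates of the [d]-th power of the primitive
    [n]-th root of unity; indexing by natural numbers keeps every reduction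
    modulo [n] inside [nat]. *)
Definition cosn (d : nat) : R := cos (2 * pi * d%:R / n%:R).
Definition sinn (d : nat) : R := sin (2 * pi * d%:R / n%:R).

Lemma cosn0 : cosn 0 = 1.
Proof. by rewrite /cosn mulr0 mul0r cos0. Qed.

Lemma sinn0 : sinn 0 = 0.
Proof. by rewrite /sinn mulr0 mul0r sin0. Qed.

Lemma cosnD a b : cosn (a + b) = cosn a * cosn b - sinn a * sinn b.
Proof. by rewrite /cosn natrD mulrDr mulrDl cosD. Qed.

Lemma sinnD a b : sinn (a + b) = sinn a * cosn b + cosn a * sinn b.
Proof. by rewrite /sinn natrD mulrDr mulrDl sinD. Qed.

Lemma cosn2Dsinn2 d : cosn d ^+ 2 + sinn d ^+ 2 = 1.
Proof. exact: cos2Dsin2. Qed.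

(** Subtraction formulas written so that no truncated difference of natural
    numbers occurs. *)
Lemma cosnDK a b : cosn a = cosn (a + b) * cosn b + sinn (a + b) * sinn b.
Proof. rewrite -[LHS]mulr1 -(cosn2Dsinn2 b) cosnD sinnD; ring. Qed.

Lemma sinnDK a b : sinn a = sinn (a + b) * cosn b - cosn (a + b) * sinn b.
Proof. rewrite -[LHS]mulr1 -(cosn2Dsinn2 b) cosnD sinnD; ring. Qed.

Hypothesis n_gt0 : (0 < n)%N.

Let nR_neq0 : n%:R != 0 :> R.
Proof. by rewrite pnatr_eq0 -lt0n. Qed.

Lemma cosnn : cosn n = 1.
Proof. by rewrite /cosn mulfK // mulr_natl cos2pi. Qed.

Lemma sinnn : sinn n = 0.
Proof. by rewrite /sinn mulfK // mulr_natl sin2pi. Qed.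

Lemma cosn_sinn_mul q : cosn (q * n) = 1 /\ sinn (q * n) = 0.
Proof.
elim: q => [|q [IHc IHs]]; first by rewrite mul0n cosn0 sinn0.
rewrite mulSn cosnD sinnD IHc IHs cosnn sinnn; split; ring.
Qed.

Lemma cosn_modn d : cosn (d %% n) = cosn d.
Proof.
rewrite [in RHS](divn_eq d n) addnC cosnD.
by have [-> ->] := cosn_sinn_mul (d %/ n); rewrite mulr1 mulr0 subr0.
Qed.

Lemma sinn_modn d : sinn (d %% n) = sinn d.
Proof.
rewrite [in RHS](divn_eq d n) addnC sinnD.
by have [-> ->] := cosn_sinn_mul (d %/ n); rewrite mulr1 mulr0 addr0.
Qed.

Lemma cosn_eq1 d : (cosn d == 1) = (n %| d)%N.
Proof.
rewrite /dvdn -cosn_modn; have := ltn_pmod d n_gt0; move: (d %% n)%N => r r_lt.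
have [->|r_neq0] := eqVneq r 0; first by rewrite cosn0 eqxx.
apply/negbTE/eqP => cos_r.
have r_gt0 : (0 < r)%N by rewrite lt0n.
have : 0 < sin (pi * r%:R / n%:R) :> R.
  apply: sin_gt0_pi; rewrite divr_gt0 ?mulr_gt0 ?pi_gt0 ?ltr0n //=.
  by rewrite -mulrA gtr_pMr ?pi_gt0 // ltr_pdivrMr ?ltr0n // mul1r ltr_nat.
have := cos_mulr2n (pi * r%:R / n%:R : R).
rewrite (_ : pi * r%:R / n%:R *+ 2 = 2 * pi * r%:R / n%:R); last by rewrite -[LHS]mulr_natl !mulrA.
rewrite -/(cosn r) cos_r.
have := cos2Dsin2 (pi * r%:R / n%:R : R).
move: (cos _) (sin _) => c s; nra.
Qed.

Lemma sinn_of_cosn1 d : cosn d = 1 -> sinn d = 0.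
Proof.
move=> c1; have := cosn2Dsinn2 d; rewrite c1 => h; apply/eqP; rewrite -sqrf_eq0; apply/eqP; lra.
Qed.

Lemma eq_cosn_sinn u v : (u <= v)%N ->
  cosn u = cosn v /\ sinn u = sinn v <-> (n %| v - u)%N.
Proof.
move=> /subnKC; move: (v - u)%N => d <-; rewrite -cosn_eq1 cosnD sinnD; split.
  move=> [ec es]; apply/eqP.
  rewrite -[LHS]mulr1 -(cosn2Dsinn2 u) mulrDr.
  transitivity (cosn u * (cosn u * cosn d - sinn u * sinn d) +
                sinn u * (sinn u * cosn d + cosn u * sinn d)); first by ring.
  by rewrite -ec -es -!expr2.
by move=> /eqP c1; rewrite c1 (sinn_of_cosn1 c1); split; ring.
Qed.

(** [cosn (d * a)] is the [d]-th Chebyshev polynomial in [cosn a]. Hence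
    two frequencies with the same eigenvalue have the same cosine function. *)
Lemma eq_cosn_mul a b d : cosn a = cosn b -> cosn (d * a) = cosn (d * b).
Proof.
move=> ab; have rec c e : cosn (e.+2 * c) = 2 * cosn c * cosn (e.+1 * c) - cosn (e * c).
  rewrite (cosnDK (e * c) c) -mulSnr (mulSnr e.+1) cosnD; ring.
suff [] : cosn (d * a) = cosn (d * b) /\ cosn (d.+1 * a) = cosn (d.+1 * b) by [].
elim: d => [|d [IH IH1]]; first by rewrite !mul0n !mul1n.
by rewrite !rec IH IH1 ab.
Qed.

(** The sum [S] of cosines and the sum [T] of sines are unchanged by the shift
    of the index, which rotates the vector [(S, T)] by the angle of [d]; when
    that rotation is not the identity the vector must vanish. *)
Lemma sum_cosn d : \sum_(k < n) cosn (k * d) = (if (n %| d)%N then n%:R else 0).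
Proof.
case: ifP => [nd|/negbT nd].
  rewrite -[n in RHS]card_ord -sumr_const; apply: eq_bigr => k _.
  by apply/eqP; rewrite cosn_eq1 dvdn_mull.
have shift (f : nat -> R) : f n = f 0%N -> \sum_(k < n) f k.+1 = \sum_(k < n) f k.
  move=> fn; have : \sum_(k < n.+1) f k = \sum_(k < n) f k + f n by rewrite big_ord_recr.
  rewrite big_ord_recl /= fn [RHS]addrC => /addrI; exact.
set S := \sum__ _; set T := \sum_(k < n) sinn (k * d).
have nd_ : cosn (n * d) = 1 by apply/eqP; rewrite cosn_eq1 dvdn_mulr.
have ES : S * cosn d - T * sinn d = S.
  rewrite -[RHS](shift (fun k => cosn (k * d))); last by rewrite mul0n cosn0.
  by rewrite !mulr_suml -sumrB; apply: eq_bigr => k _; rewrite mulSnr cosnD.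
have ET : T * cosn d + S * sinn d = T.
  rewrite -[RHS](shift (fun k => sinn (k * d))); last by rewrite mul0n sinn0 sinn_of_cosn1.
  by rewrite !mulr_suml -big_split; apply: eq_bigr => k _; rewrite mulSnr sinnD.
have : (cosn d - 1) != 0 by rewrite subr_eq0 cosn_eq1.
have := cosn2Dsinn2 d; move: (cosn d) (sinn d) ES ET => c s ES ET cs c1.
apply: (mulIf c1); rewrite mul0r; nra.
Qed.

(** Real discrete Fourier inversion. It gives both the completeness of the
    trigonometric eigenvectors and the list of eigenvalues. *)
Lemma fourier_inversion (f : 'I_n -> R) (v : 'I_n) :
  \sum_(k < n) (cosn (k * v) * (\sum_u f u * cosn (k * u)) +
                sinn (k * v) * (\sum_u f u * sinn (k * u))) = n%:R * f v.
Proof.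
(* [v + (n - u)] stands for the difference of [v] and [u] modulo [n] *)
transitivity (\sum_u f u * \sum_(k < n) cosn (k * (v + (n - u)))).
  under [RHS]eq_bigr do rewrite mulr_sumr.
  rewrite exchange_big /=; apply: eq_bigr => k _.
  rewrite !mulr_sumr -big_split; apply: eq_bigr => u _ /=.
  rewrite (cosnDK (k * (v + (n - u))) (k * u)) -mulnDr -addnA subnK ?(ltnW (ltn_ord u)) //.
  rewrite mulnDr addnC -(cosn_modn (_ + _)) -(sinn_modn (_ + _)) modnMDl cosn_modn sinn_modn; ring.
rewrite (bigD1 v) //= [X in _ + X]big1 => [|u u_neq_v].
  by rewrite addr0 sum_cosn subnKC ?(ltnW (ltn_ord v)) // dvdnn mulrC.
rewrite sum_cosn ifN ?mulr0 //.
apply: contra u_neq_v => /dvdnP[q eq_q]; apply/eqP/val_inj => /=.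
have := ltn_ord u; have := ltn_ord v; move: eq_q.
case: q => [|[|q]]; rewrite ?mul0n ?mul1n ?mulSn; lia.
Qed.

End RootsOfUnity.

(** * The spectrum of the cycle *)

Section Spectrum.
Variables (R : realType) (n : nat).
Hypothesis n_gt2 : (2 < n)%N.
Let n_gt0 : (0 < n)%N. Proof. by case: n n_gt2. Qed.

Local Notation C := (cycle_op R n).
Local Notation cosn := (cosn R n).
Local Notation sinn := (sinn R n).

Definition trig_row (j : nat) (x y : R) : 'rV[R]_n :=
  \row_v (x * cosn (j * v) + y * sinn (j * v)).

(** Two distinct neighbours, so that both terms occur in [cycle_opE]; this is
    where [n > 2] is used. *)
Lemma ordS_neq_pred (u : 'I_n) : ordS u != ord_pred u.
Proof.
apply/eqP => ordS_pred; have u_lt := ltn_ord u.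
have : (u.+1 %% n = (u + n).-1 %% n)%N := congr1 val ordS_pred.
have [->|u_gt0] := posnP u.
  by rewrite add0n [(n.-1 %% n)%N]modn_small ?modn_small; lia.
have -> : (u + n).-1 = (u.-1 + n)%N by lia.
rewrite modnDr [(u.-1 %% n)%N]modn_small; last lia.
have [u_last|u_neq] := eqVneq u.+1 n; first by rewrite u_last modnn; lia.
by rewrite modn_small; lia.
Qed.

Lemma cycle_opE (phi : 'rV[R]_n) v :
  (phi *m C) ord0 v = (phi ord0 (ord_pred v) + phi ord0 (ordS v)) / 2.
Proof.
rewrite mxE (bigD1 (ord_pred v)) //= (bigD1 (ordS v)) /=; last exact: ordS_neq_pred.
rewrite big1 => [|u /andP[/negPf u_pred /negPf u_S]].
  by rewrite !mxE /cycle_adj ord_predK !eqxx orbT /=; field.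
rewrite !mxE /cycle_adj u_S orbF.
suff -> : v == ordS u = false by rewrite !mulr0.
by apply/negbTE; move/negbT: u_pred; apply: contra => /eqP ->; rewrite ordSK.
Qed.

Lemma cycle_op_sym : C^T = C.
Proof.
by apply/matrixP=> u v; rewrite !mxE /cycle_adj orbC.
Qed.

Lemma trig_row_eigen j x y : (trig_row j x y <= Lambda R n j)%MS.
Proof.
apply/eigenspaceP/rowP => v; rewrite cycle_opE !mxE.
have shiftS : cosn (j * ordS v) = cosn (j * v + j) /\ sinn (j * ordS v) = sinn (j * v + j).
  rewrite /= -mulnSr -(cosn_modn _ n_gt0) -(sinn_modn _ n_gt0) modnMmr.
  by rewrite cosn_modn ?sinn_modn.
have shiftP : cosn (j * v) = cosn (j * ord_pred v + j) /\
              sinn (j * v) = sinn (j * ord_pred v + j).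
  rewrite -mulnSr -{1 3}(ord_predK v) /=.
  rewrite -(cosn_modn _ n_gt0) -(sinn_modn _ n_gt0) modnMmr.
  by rewrite cosn_modn ?sinn_modn.
rewrite (cosnDK _ _ (j * ord_pred v) j) (sinnDK _ _ (j * ord_pred v) j).
have [-> ->] := shiftS; have [<- <-] := shiftP.
by rewrite cosnD sinnD -/(cosn j); field.
Qed.

Definition dot (phi psi : 'rV[R]_n) : R := \sum_v phi ord0 v * psi ord0 v.

Lemma eigenspace_orthogonal x y (phi psi : 'rV[R]_n) : x != y ->
  (phi <= eigenspace C x)%MS -> (psi <= eigenspace C y)%MS -> dot phi psi = 0.
Proof.
move=> x_neq_y /eigenspaceP phi_x /eigenspaceP psi_y.
have dotE (a b : 'rV[R]_n) : dot a b = (a *m b^T) ord0 ord0.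
  by rewrite mxE; apply: eq_bigr => v _; rewrite mxE.
suff /eqP : x * dot phi psi = y * dot phi psi.
  by rewrite -subr_eq0 -mulrBl mulf_eq0 subr_eq0 (negPf x_neq_y) => /eqP.
rewrite !dotE.
transitivity ((phi *m C *m psi^T) ord0 ord0); first by rewrite phi_x -scalemxAl [RHS]mxE.
by rewrite -mulmxA -{1}cycle_op_sym -trmx_mul psi_y linearZ -scalemxAr mxE.
Qed.

Lemma row_fourier (phi : 'rV[R]_n) :
  phi = n%:R^-1 *: \sum_(k < n)
    trig_row k (dot phi (trig_row k 1 0)) (dot phi (trig_row k 0 1)).
Proof.
apply/rowP => v; rewrite mxE summxE; apply: (mulfI (x := n%:R)).
  by rewrite pnatr_eq0 -lt0n.
rewrite mulVKf ?pnatr_eq0 -?lt0n // -(fourier_inversion n_gt0 (fun u => phi ord0 u)).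
apply: eq_bigr => k _; rewrite mxE mulrC [_ * sinn _]mulrC /dot.
by congr (_ * _ + _ * _); apply: eq_bigr => u _; rewrite mxE; ring.
Qed.

(** Completeness in the form used for designs: the Fourier components of [phi]
    at frequencies of another eigenvalue vanish, and the other components lie
    in the eigenspace. *)
Lemma in_eigenspace_of_orthogonal x (phi : 'rV[R]_n) :
  (forall k : 'I_n, cosn k != x -> forall a b, dot phi (trig_row k a b) = 0) ->
  (phi <= eigenspace C x)%MS.
Proof.
move=> ortho; rewrite (row_fourier phi) scalemx_sub // summx_sub // => k _.
have [<-|k_neq] := eqVneq (cosn k) x; first exact: trig_row_eigen.
rewrite !ortho // (_ : trig_row k 0 0 = 0) ?sub0mx //.
by apply/rowP => v; rewrite !mxE !mul0r addr0.
Qed.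

(** An eigenvector of any other eigenvalue would be orthogonal to all the
    trigonometric eigenvectors, hence zero by Fourier inversion. *)
Lemma eigenvalue_cycle_op x : eigenvalue C x = [exists k : 'I_n, cosn k == x].
Proof.
apply/eigenvalueP/existsP => [[phi phi_x phi_neq0]|[k /eqP <-]]; last first.
  exists (trig_row k 1 0); first exact/eigenspaceP/trig_row_eigen.
  apply/eqP => /rowP /(_ (Ordinal n_gt0)); rewrite !mxE muln0 cosn0 mul0r addr0 mul1r.
  by move/eqP; rewrite oner_eq0.
apply/existsP; apply: contra_neqT phi_neq0 => /existsPn no_k.
rewrite (row_fourier phi) big1 ?scaler0 // => k _.
have ortho a b : dot phi (trig_row k a b) = 0.
  apply: (@eigenspace_orthogonal x (cosn k)); last exact: trig_row_eigen.
    by rewrite eq_sym no_k.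
  exact/eigenspaceP.
by rewrite !ortho; apply/rowP => v; rewrite !mxE !mul0r addr0.
Qed.

(** Only the frequencies [k] with [cosn k = cosn j] contribute to the Fourier
    expansion of [phi]. The component at [k] is a convolution with
    [d |-> cosn (d * k)], which is the same function as [d |-> cosn (d * j)]. *)
Lemma LambdaP j (phi : 'rV[R]_n) :
  reflect (exists x y, phi = trig_row j x y) (phi <= Lambda R n j)%MS.
Proof.
apply: (iffP idP) => [phi_j|[x [y ->]]]; last exact: trig_row_eigen.
have trig_sum (I : finType) (F : I -> 'rV[R]_n) :
    (forall i, exists x y, F i = trig_row j x y) ->
    exists x y, \sum_i F i = trig_row j x y.
  move=> FE; elim/big_ind: _ => // [|_ _ [x [y ->]] [x' [y' ->]]].
    by exists 0, 0; apply/rowP => v; rewrite !mxE; ring.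
  by exists (x + x'), (y + y'); apply/rowP => v; rewrite !mxE; ring.
have term (k : 'I_n) : exists x y,
  trig_row k (dot phi (trig_row k 1 0)) (dot phi (trig_row k 0 1)) = trig_row j x y.
  have [kj|k_neq_j] := eqVneq (cosn k) (cosn j); last first.
    exists 0, 0; rewrite !(eigenspace_orthogonal _ phi_j (trig_row_eigen _ _ _)) 1?eq_sym //.
    by apply/rowP => v; rewrite !mxE; ring.
  have [x [y xy]] := trig_sum _ (fun u : 'I_n =>
    trig_row j (phi ord0 u * cosn (j * u)) (phi ord0 u * sinn (j * u)))
    (fun u => ex_intro _ _ (ex_intro _ _ erefl)).
  exists x, y; rewrite -xy; apply/rowP => v; rewrite summxE !mxE /dot !mulr_suml -big_split.
  apply: eq_bigr => u _; rewrite !mxE.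
  transitivity (phi ord0 u * (cosn (k * v) * cosn (k * u) + sinn (k * v) * sinn (k * u))).
    rewrite /=; ring.
  transitivity (phi ord0 u * (cosn (j * v) * cosn (j * u) + sinn (j * v) * sinn (j * u)));
    last by ring.
  congr (_ * _).
  have diff i : cosn (i * v) * cosn (i * u) + sinn (i * v) * sinn (i * u)
              = cosn ((v + (n - u)) * i).
    rewrite [RHS](cosnDK _ _ _ (u * i)) -mulnDl -addnA subnK ?(ltnW (ltn_ord u)) //.
    rewrite (mulnC _ i) (mulnC u) mulnDr addnC -(cosn_modn _ n_gt0 (_ + _)).
    rewrite -(sinn_modn _ n_gt0 (_ + _)) modnMDl.
    by rewrite cosn_modn ?sinn_modn.
  by rewrite !diff; apply: eq_cosn_mul.
have [x [y sumE]] := trig_sum _ _ term.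
exists (n%:R^-1 * x), (n%:R^-1 * y); rewrite {1}(row_fourier phi) sumE.
by apply/rowP => v; rewrite !mxE; ring.
Qed.

Lemma eigenspace1 : (eigenspace C 1 == (const_mx 1 : 'rV[R]_n))%MS.
Proof.
rewrite -[X in eigenspace _ X](cosn0 R n).
apply/andP; split.
  apply/rV_subP => phi /LambdaP [x [y ->]].
  suff -> : trig_row 0 x y = x *: const_mx 1 by rewrite scalemx_sub ?submx_refl.
  by apply/rowP => v; rewrite !mxE mul0n cosn0 sinn0; ring.
by apply/LambdaP; exists 1, 0; apply/rowP => v; rewrite !mxE mul0n cosn0 sinn0; ring.
Qed.

(** The deviation of the weights from the uniform weight is orthogonal to
    every eigenspace but the last one, so it lies in the last one, and off [W]
    it equals [- 1/n]; rescaling gives a function of the last eigenspace equal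
    to 1 off [W]. Conversely such a function determines the weights. *)
Lemma extremal_designP (s : seq R) j (W : {set 'I_n}) :
  (forall x, (x \in s) = eigenvalue C x) -> last 0 s = cosn j ->
  extremal_design C s W <->
  exists x y, forall v, v \notin W -> trig_row j x y ord0 v = 1.
Proof.
move=> sE last_s.
have nR_neq0 : n%:R != 0 :> R by rewrite pnatr_eq0 -lt0n.
pose dev (a : 'I_n -> R) : 'rV[R]_n := \row_v ((if v \in W then a v else 0) - n%:R^-1).
have dev_dot a phi : dot (dev a) phi =
    \sum_(w in W) a w * phi ord0 w - n%:R^-1 * \sum_v phi ord0 v.
  rewrite big_mkcond mulr_sumr -sumrB; apply: eq_bigr => v _.
  by rewrite mxE mulrBl; case: ifP => // _; rewrite mul0r.
have devP a L : averages W a L <-> forall phi : 'rV[R]_n, (phi <= L)%MS -> dot (dev a) phi = 0.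
  split=> h phi /h; rewrite dev_dot; first by move->; rewrite subrr.
  by move/eqP; rewrite subr_eq0 => /eqP.
split=> [[a a_design]|[x [y xy]]].
  have /LambdaP[x [y devE]] : (dev a <= Lambda R n j)%MS.
    apply: in_eigenspace_of_orthogonal => k k_neq b c.
    have /devP dev_ortho : averages W a (eigenspace C (cosn k)).
      apply: a_design; last by rewrite last_s.
      by rewrite sE eigenvalue_cycle_op; apply/existsP; exists k.
    by apply: dev_ortho; exact: trig_row_eigen.
  exists (- n%:R * x), (- n%:R * y) => v vW.
  move/rowP/(_ v): devE; rewrite !mxE (negPf vW) sub0r => devE.
  rewrite -!mulrA -mulrDr -devE; field.
  exact: nR_neq0.
pose a v := n%:R^-1 * (1 - trig_row j x y ord0 v).
have devE : dev a = - n%:R^-1 *: trig_row j x y.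
  apply/rowP => v; rewrite mxE [RHS]mxE /a.
  case: ifPn => [_|/xy ->]; last by ring.
  by ring.
exists a => z _; rewrite last_s => z_neq; apply/devP => phi phi_z.
rewrite devE; apply: (eigenspace_orthogonal _ _ phi_z).
  by rewrite eq_sym; exact: z_neq.
by rewrite scalemx_sub // trig_row_eigen.
Qed.

End Spectrum.

(** * Level sets on the last eigenspace *)

(** A line that meets the unit circle meets it in at most two points: writing
    [t] for the coordinate along the line [x c + y s = 1], the points of the
    circle satisfy [t ^ 2 = x ^ 2 + y ^ 2 - 1]. *)
Lemma unit_circle_line (R : realFieldType) (x y c1 s1 c2 s2 c3 s3 : R) :
  c1 ^+ 2 + s1 ^+ 2 = 1 -> c2 ^+ 2 + s2 ^+ 2 = 1 -> c3 ^+ 2 + s3 ^+ 2 = 1 ->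
  x * c1 + y * s1 = 1 -> x * c2 + y * s2 = 1 -> x * c3 + y * s3 = 1 ->
  (c1, s1) != (c2, s2) -> (c3, s3) = (c1, s1) \/ (c3, s3) = (c2, s2).
Proof.
move=> u1 u2 u3 l1 l2 l3.
pose t c s : R := x * s - y * c; pose N := x ^+ 2 + y ^+ 2.
have t_sqr c s : c ^+ 2 + s ^+ 2 = 1 -> x * c + y * s = 1 -> t c s ^+ 2 = N - 1.
  move=> u l; transitivity (N * (c ^+ 2 + s ^+ 2) - (x * c + y * s) ^+ 2).
    by rewrite /t /N; ring.
  by rewrite u l mulr1 expr1n.
have N_neq0 : N != 0.
  apply/eqP => N0; have := sqr_ge0 (t c1 s1); rewrite (t_sqr _ _ u1 l1) N0; lra.
have t_inj c s c' s' : x * c + y * s = 1 -> x * c' + y * s' = 1 ->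
    t c s = t c' s' -> (c, s) = (c', s').
  move=> l l' tt'; congr pair; apply: (mulfI N_neq0).
    transitivity (x * (x * c + y * s) - y * t c s); first by rewrite /t /N; ring.
    by rewrite tt' l -l' /t /N; ring.
  transitivity (y * (x * c + y * s) + x * t c s); first by rewrite /t /N; ring.
  by rewrite tt' l -l' /t /N; ring.
move=> p12.
have /eqP : t c3 s3 ^+ 2 = t c1 s1 ^+ 2 by rewrite !t_sqr.
rewrite eqf_sqr => /orP[/eqP t31|/eqP t31]; first by left; exact: t_inj t31.
have /eqP : t c2 s2 ^+ 2 = t c1 s1 ^+ 2 by rewrite !t_sqr.
rewrite eqf_sqr => /orP[/eqP t21|/eqP t21].
  by case/eqP: p12; symmetry; exact: t_inj t21.
by right; apply: t_inj => //; rewrite t31 t21.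
Qed.

Section LevelSets.
Variables (R : realType) (n j : nat).
Hypothesis n_gt2 : (2 < n)%N.
Let n_gt0 : (0 < n)%N. Proof. by case: n n_gt2. Qed.

Local Notation C := (cycle_op R n).
Local Notation cosn := (cosn R n).
Local Notation sinn := (sinn R n).

Definition circle_pt (v : 'I_n) : R * R := (cosn (j * v), sinn (j * v)).

Definition fiber (u : 'I_n) : {set 'I_n} := [set v | circle_pt v == circle_pt u].

Definition level (x y : R) : {set 'I_n} := [set v | trig_row n j x y ord0 v == 1].

Lemma in_level x y v :
  (v \in level x y) = (x * (circle_pt v).1 + y * (circle_pt v).2 == 1).
Proof. by rewrite inE mxE. Qed.

Lemma level_fibers x y u v : u \in level x y -> v \in level x y ->
  circle_pt u != circle_pt v -> level x y = fiber u :|: fiber v.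
Proof.
rewrite !in_level => /eqP lu /eqP lv uv; apply/setP => w; rewrite in_level !inE.
apply/eqP/orP => [lw|[] /eqP -> //].
have unit_pt (z : 'I_n) := cosn2Dsinn2 R n (j * z).
have := unit_circle_line (unit_pt u) (unit_pt v) (unit_pt w) lu lv lw uv.
by case=> /eqP ?; [left|right].
Qed.

(** A function of [Lambda j] that takes the value 1 on one fiber at most can be
    replaced by one taking it also on the next vertex: the points of [u] and
    of its successor are linearly independent because their determinant is
    [sinn j], and Cramer's rule gives the coefficients. *)
Lemma level_extension x y : sinn j != 0 ->
  exists x' y' u v, [/\ level x y \subset level x' y',
    level x' y' = fiber u :|: fiber v & circle_pt u != circle_pt v].
Proof.
move=> sin_j.
have [[u [v [lu lv uv]]]|no_pair] := pselect (exists u v,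
    [/\ u \in level x y, v \in level x y & circle_pt u != circle_pt v]).
  by exists x, y, u, v; split => //; exact: level_fibers.
have [u sub_u] : exists u, level x y \subset fiber u.
  have [->|/finset.set0Pn[u lu]] := eqVneq (level x y) finset.set0.
    by exists (Ordinal n_gt0); exact: finset.sub0set.
  exists u; apply/fintype.subsetP => v lv; rewrite inE; apply: contrapT => /negP vu.
  by apply: no_pair; exists v, u.
have ordS_pt : circle_pt (ordS u) = (cosn (j * u + j), sinn (j * u + j)).
  rewrite /circle_pt /= -mulnSr -(cosn_modn _ n_gt0) -(sinn_modn _ n_gt0) modnMmr.
  by rewrite cosn_modn ?sinn_modn.
pose D := (circle_pt u).1 * (circle_pt (ordS u)).2 -
          (circle_pt (ordS u)).1 * (circle_pt u).2.
have D_sin : D = sinn j.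
  rewrite /D ordS_pt /= cosnD sinnD -[RHS]mulr1 -(cosn2Dsinn2 R n (j * u)); ring.
have D_neq0 : D != 0 by rewrite D_sin.
pose x' := ((circle_pt (ordS u)).2 - (circle_pt u).2) / D.
pose y' := ((circle_pt u).1 - (circle_pt (ordS u)).1) / D.
have pts_neq : circle_pt u != circle_pt (ordS u).
  by apply: contra_neq D_neq0 => eq_pt; rewrite /D -eq_pt; ring.
have lu : u \in level x' y'.
  by rewrite in_level /x' /y'; apply/eqP; move: D_neq0; rewrite /D => ?; field.
have lv : ordS u \in level x' y'.
  by rewrite in_level /x' /y'; apply/eqP; move: D_neq0; rewrite /D => ?; field.
have level_eq := level_fibers lu lv pts_neq.
exists x', y', u, (ordS u); split=> //.
by rewrite level_eq; apply: fintype.subset_trans sub_u _; exact: finset.subsetUl.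
Qed.

(** Complements of designs are the subsets of level sets; by [level_extension]
    the maximal ones are the level sets made of two fibers. *)
Lemma card_minimal_design (s : seq R) (g : nat) (W : {set 'I_n}) :
  (forall x, (x \in s) = eigenvalue C x) -> last 0 s = cosn j -> sinn j != 0 ->
  (forall u, #|fiber u| = g) ->
  minimal_extremal_design C s W -> #|W| = (n - 2 * g)%N.
Proof.
move=> sE last_s sin_j card_fiber [W_design W_min].
have designP W' : extremal_design C s W' <-> exists x y, ~: W' \subset level x y.
  split=> [/(extremal_designP n_gt2 _ sE last_s)[x [y xy]]|[x [y /fintype.subsetP xy]]].
    by exists x, y; apply/fintype.subsetP => v; rewrite !inE => /xy ->.
  apply/(extremal_designP n_gt2 _ sE last_s); exists x, y => v vW.
  by apply/eqP; have := xy v; rewrite !inE; apply.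
have /designP[x [y sub_xy]] := W_design.
have [x' [y' [u [v [sub_xy' level_eq uv]]]]] := level_extension x y sin_j.
have <- : ~: level x' y' = W.
  apply: W_min; last by apply/designP; exists x', y'; rewrite finset.setCK.
  by rewrite finset.subCset; exact: fintype.subset_trans sub_xy sub_xy'.
have := cardsC (level x' y'); rewrite card_ord => card_eq.
have card_level : #|level x' y'| = (2 * g)%N.
  rewrite level_eq cardsU !card_fiber (_ : _ :&: _ = finset.set0) ?cards0; first lia.
  apply/setP => w; rewrite !inE; apply/negbTE/negP => /andP[/eqP -> ].
  by apply/negP.
by move: card_eq; rewrite card_level; lia.
Qed.

Lemma mem_fiber (u v : 'I_n) : (u <= v)%N ->
  ((v \in fiber u) = (n %| j * (v - u)))%N * ((u \in fiber v) = (n %| j * (v - u)))%N.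
Proof.
move=> le_uv; have := eq_cosn_sinn R n_gt0 (leq_mul (leqnn j) le_uv).
rewrite -mulnBr => root_eq.
have fiberE : (u \in fiber v) = (n %| j * (v - u))%N.
  rewrite inE xpair_eqE; apply/andP/idP => [[/eqP ec /eqP es]|/root_eq[-> ->]] //.
  exact/root_eq.
by split=> //; rewrite -fiberE !inE eq_sym.
Qed.

Lemma card_fiber_coprime u : coprime j n -> #|fiber u| = 1%N.
Proof.
move=> co_jn; rewrite (_ : fiber u = [set u]) ?cards1 //; apply/setP => v.
rewrite finset.in_set1; apply/idP/eqP => [|->]; last by rewrite inE.
have lt_u := ltn_ord u; have lt_v := ltn_ord v.
case/orP: (leq_total u v) => le_uv; rewrite (mem_fiber le_uv) Gauss_dvdr 1?coprime_sym //.
  by move=> /dvdnP[[|q]]; rewrite ?mul0n ?mulSn => eq_q; apply/val_inj => /=; lia.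
by move=> /dvdnP[[|q]]; rewrite ?mul0n ?mulSn => eq_q; apply/val_inj => /=; lia.
Qed.

(** For even [j] the map to the circle factors through the residue modulo [m],
    so that antipodal vertices of the cycle share their point. *)
Lemma card_fiber_even m u : n = (2 * m)%N -> ~~ odd j -> coprime j m ->
  #|fiber u| = 2%N.
Proof.
move=> nE j_even co_jm.
have jE : j = (2 * j./2)%N by rewrite mul2n even_halfK.
have dvdE d : (n %| j * d)%N = (m %| d)%N.
  rewrite {1}jE nE -mulnA dvdn_pmul2l // Gauss_dvdr // coprime_sym.
  by move: co_jm; rewrite {1}jE coprimeMl => /andP[].
have lt_u := ltn_ord u.
have far_lt : ((if u < m then u + m else u - m) < n)%N by case: ifP; lia.
rewrite (_ : fiber u = [set u; Ordinal far_lt]).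
  rewrite cards2 (_ : u != _) //; apply/eqP => /(congr1 val) /=.
  by case: ifP; lia.
apply/setP => v; rewrite finset.in_set2; have lt_v := ltn_ord v.
have -> : (v == Ordinal far_lt) = (v == (if u < m then u + m else u - m) :> nat)%N.
  by [].
have [le_uv|le_vu] := leqP u v.
  rewrite (mem_fiber le_uv) dvdE; apply/dvdnP/orP => [[q eq_q]|].
    have /orP[/eqP q0|/eqP q1] : ((q == 0) || (q == 1))%N by nia.
      by left; apply/eqP/val_inj => /=; move: eq_q; rewrite q0; lia.
    by right; apply/eqP; move: eq_q; rewrite q1; case: ifP; lia.
  case=> [/eqP ->|/eqP vE]; first by exists 0%N; rewrite subnn.
  by exists 1%N; move: vE; case: ifP; lia.
rewrite (mem_fiber (ltnW le_vu)) dvdE; apply/dvdnP/orP => [[q eq_q]|].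
  have /orP[/eqP q0|/eqP q1] : ((q == 0) || (q == 1))%N by nia.
    by left; apply/eqP/val_inj => /=; move: eq_q; rewrite q0; lia.
  by right; apply/eqP; move: eq_q; rewrite q1; case: ifP; lia.
case=> [/eqP ->|/eqP vE]; first by exists 0%N; rewrite subnn.
by exists 1%N; move: vE; case: ifP; lia.
Qed.

End LevelSets.

(** * The eigenvalues of least absolute value *)

Section HalfTurn.
Variables (R : realType) (m : nat).
Hypothesis m_gt0 : (0 < m)%N.
Local Notation cosn := (cosn R (2 * m)).
Local Notation sinn := (sinn R (2 * m)).

Lemma angle_half d : 2 * pi * d%:R / (2 * m)%:R = pi * d%:R / m%:R :> R.
Proof.
have m_neq0 : m%:R != 0 :> R by rewrite pnatr_eq0 -lt0n.
by rewrite natrM; field.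
Qed.

Lemma cosnE d : cosn d = cos (pi * d%:R / m%:R).
Proof. exact: (congr1 cos (angle_half d)). Qed.

Lemma sinnE d : sinn d = sin (pi * d%:R / m%:R).
Proof. exact: (congr1 sin (angle_half d)). Qed.

Lemma cosn_half : cosn m = -1.
Proof. by rewrite cosnE mulfK ?cospi // pnatr_eq0 -lt0n. Qed.

Lemma sinn_half : sinn m = 0.
Proof. by rewrite sinnE mulfK ?sinpi // pnatr_eq0 -lt0n. Qed.

Lemma cosn_half_sub k : (k <= m)%N -> cosn (m - k) = - cosn k.
Proof.
by move=> le_km; rewrite (cosnDK _ _ _ k) subnK // cosn_half sinn_half; ring.
Qed.

Lemma norm_cosn_mod k : `|cosn (k %% m)| = `|cosn k|.
Proof.
rewrite [in RHS](divn_eq k m); elim: (k %/ m)%N => [|q IH]; first by rewrite mul0n.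
by rewrite IH mulSn -addnA [in RHS]cosnD cosn_half sinn_half mul0r subr0 mulN1r normrN.
Qed.

Lemma cosn_anti k l : (k <= l)%N -> (l <= m)%N -> cosn l <= cosn k.
Proof.
move=> le_kl le_lm; rewrite !cosnE.
have m_gt0R : 0 < m%:R :> R by rewrite ltr0n.
have in0pi i : (i <= m)%N -> pi * i%:R / m%:R \in `[0, pi : R].
  move=> le_im; rewrite in_itv /= divr_ge0 ?mulr_ge0 ?pi_ge0 ?ler0n //=.
  by rewrite ler_pdivrMr // ler_pM2l ?pi_gt0 // ler_nat.
rewrite leNgt ltr_cos ?in0pi ?(leq_trans le_kl) // -leNgt.
by rewrite ler_pM2r ?invr_gt0 // ler_pM2l ?pi_gt0 // ler_nat.
Qed.

Lemma cosn_quarter_gt0 k : (2 * k < m)%N -> 0 < cosn k.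
Proof.
move=> lt_km; rewrite cosnE; apply: cos_gt0_pihalf.
have m_gt0R : 0 < m%:R :> R by rewrite ltr0n.
have := pi_gt0 R => pi_gt0.
apply/andP; split.
  by apply: (@lt_le_trans _ _ 0); rewrite ?divr_ge0 ?mulr_ge0 ?(ltW pi_gt0) //; lra.
rewrite ltr_pdivrMr // -mulrA ltr_pM2l //.
by rewrite ltr_pdivlMl // -natrM ltr_nat.
Qed.

(** Up to sign [cosn k] depends on [k] modulo [m] only, and [k] may be replaced
    by [m - k]; the remaining range [0..l] ends just before the quarter turn. *)
Lemma norm_cosn_min k l : (m = 2 * l + 1)%N -> cosn l <= `|cosn k|.
Proof.
move=> mE; rewrite -norm_cosn_mod; have := ltn_pmod k m_gt0.
move: (k %% m)%N => r lt_rm; have [le_rl|lt_lr] := leqP r l.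
  by apply: le_trans (ler_norm _); apply: cosn_anti => //; lia.
rewrite -normrN -cosn_half_sub; last exact: ltnW.
by apply: le_trans (ler_norm _); apply: cosn_anti; lia.
Qed.

Lemma sinn_neq0 j : (0 < j < m)%N -> sinn j != 0.
Proof.
move=> /andP[j_gt0 lt_jm]; rewrite sinnE; apply: lt0r_neq0.
have m_gt0R : 0 < m%:R :> R by rewrite ltr0n.
apply: sin_gt0_pi; rewrite divr_gt0 ?mulr_gt0 ?pi_gt0 ?ltr0n //=.
by rewrite ltr_pdivrMr // ltr_pM2l ?pi_gt0 // ltr_nat.
Qed.

End HalfTurn.

(** * Frequency orders *)

Section FrequencyOrder.
Variables (R : realType) (n : nat).
Hypothesis n_gt2 : (2 < n)%N.
Let n_gt0 : (0 < n)%N. Proof. by case: n n_gt2. Qed.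
Local Notation C := (cycle_op R n).
Local Notation cosn := (cosn R n).

Lemma norm_ge_trans : transitive (fun x y : R => `|y| <= `|x|).
Proof. by move=> y x z yx zy; exact: le_trans zy yx. Qed.

Lemma frequency_order_last s k : frequency_order C s ->
  last 0 s \in s /\ `|last 0 s| <= `|cosn k|.
Proof.
move=> [_ sE _ s_sorted].
have cosn_in : cosn k \in s.
  rewrite sE (eigenvalue_cycle_op n_gt2); apply/existsP.
  by exists (Ordinal (ltn_pmod k n_gt0)); rewrite /= cosn_modn.
move: s_sorted cosn_in; case/lastP: s sE => // s x _.
rewrite last_rcons (sorted_pairwise norm_ge_trans) pairwise_rcons => /andP[/allP x_min _].
rewrite !mem_rcons !in_cons eqxx => cosn_in; split=> //.
by case/orP: cosn_in => [/eqP -> //|]; exact: x_min.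
Qed.

(** The constants are put first, the chosen eigenvalue last, and all the
    others are sorted in between. *)
Lemma frequency_order_exists j : cosn j != 1 ->
  (forall k, `|cosn j| <= `|cosn k|) ->
  exists s, frequency_order C s /\ last 0 s = cosn j.
Proof.
move=> j_neq1 j_min.
pose ge_abs := (fun x y : R => `|y| <= `|x|).
pose mid := [seq x <- undup [seq cosn k | k : 'I_n] | (x != 1) && (x != cosn j)].
exists (1 :: rcons (sort ge_abs mid) (cosn j)); split; last by rewrite /= last_rcons.
have midE x : (x \in mid) = [&& x != 1, x != cosn j & eigenvalue C x].
  rewrite mem_filter mem_undup (eigenvalue_cycle_op n_gt2) -andbA; congr [&& _, _ & _].
  by apply/mapP/existsP => [[k _ ->]|[k /eqP <-]]; exists k; rewrite ?mem_enum.
have eig k : eigenvalue C (cosn k).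
  rewrite (eigenvalue_cycle_op n_gt2); apply/existsP.
  by exists (Ordinal (ltn_pmod k n_gt0)); rewrite /= cosn_modn.
have norm_le1 k : `|cosn k| <= 1 := cos_max _.
split.
- rewrite /= rcons_uniq mem_rcons in_cons !mem_sort !midE !eqxx /= andbF orbF eq_sym j_neq1.
  by rewrite sort_uniq filter_uniq ?undup_uniq.
- move=> x; rewrite in_cons mem_rcons in_cons mem_sort midE.
  have [->|x_neq1] := eqVneq x 1; first by rewrite -(cosn0 R n) eig.
  by have [->|x_neqj] := eqVneq x (cosn j); rewrite ?eig.
- exact: eigenspace1.
rewrite (sorted_pairwise norm_ge_trans) /= pairwise_rcons -(sorted_pairwise norm_ge_trans).
rewrite sort_sorted ?andbT; last by move=> x y; exact: le_total.
have eig_cos x : eigenvalue C x -> exists k, x = cosn k.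
  by rewrite (eigenvalue_cycle_op n_gt2) => /existsP[k /eqP <-]; exists k.
rewrite all_rcons normr1 norm_le1 /=; apply/andP; split.
  by apply/allP => x; rewrite mem_sort midE => /and3P[_ _ /eig_cos[k ->]].
by apply/allP => x; rewrite mem_sort midE => /and3P[_ _ /eig_cos[k ->]].
Qed.

(** A common nonzero eigenvector forces equal eigenvalues; the coordinate at
    the vertex 0 of the cosine vector is 1. *)
Lemma last_eigenspace_Lambda s j :
  (last_eigenspace C s == Lambda R n j)%MS -> last 0 s = cosn j.
Proof.
move=> /andP[_ sub_last].
have trig_last := submx_trans (trig_row_eigen n_gt2 j 1 0) sub_last.
have /eigenspaceP := trig_row_eigen n_gt2 j (1 : R) 0.
move/eigenspaceP: trig_last => -> /rowP /(_ (Ordinal n_gt0)).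
by rewrite !mxE muln0 cosn0 mul0r addr0 !mulr1.
Qed.

End FrequencyOrder.

(** * Cardinalities of the minimal designs *)

Theorem theorem4p8 (R : realType) (n : nat)
    (n_ge6 : (6 <= n)%N) (n_mod4 : (n %% 4)%N = 2%N) :
  let C := cycle_op R n in
  let j1 := ((n - 2) %/ 4)%N in
  let j2 := ((n + 2) %/ 4)%N in
  [/\ (exists s : seq R, frequency_order C s /\
         (last_eigenspace C s == Lambda R n j1)%MS),
      (exists s : seq R, frequency_order C s /\
         (last_eigenspace C s == Lambda R n j2)%MS),
      (forall s : seq R, frequency_order C s ->
         (last_eigenspace C s == Lambda R n j1)%MS \/
         (last_eigenspace C s == Lambda R n j2)%MS)
    & (minimal_designs_have_card R n j1 (n - 4) /\
       minimal_designs_have_card R n j2 (n - 2)) \/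
      (minimal_designs_have_card R n j1 (n - 2) /\
       minimal_designs_have_card R n j2 (n - 4))].
Proof.
move=> C j1 j2.
have [m nE] : exists m, n = (2 * m)%N by exists (n %/ 2)%N; lia.
have mE1 : m = (2 * j1 + 1)%N by rewrite /j1; lia.
have mE2 : (m + 1 = 2 * j2)%N by rewrite /j2; lia.
have j12 : (j1 + j2 = m)%N by lia.
clearbody j1 j2.
have n_gt2 : (2 < n)%N by lia.
have m_gt0 : (0 < m)%N by lia.
have cos_j2 : cosn R n j2 = - cosn R n j1.
  by rewrite nE -cosn_half_sub //; [congr cosn; lia | lia].
have cos_j1_gt0 : 0 < cosn R n j1 by rewrite nE; apply: cosn_quarter_gt0; lia.
have cos_j1_min k : cosn R n j1 <= `|cosn R n k| by rewrite nE; apply: norm_cosn_min.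
have exists_order j : cosn R n j != 1 -> `|cosn R n j| = cosn R n j1 ->
    exists s : seq R, frequency_order C s /\ (last_eigenspace C s == Lambda R n j)%MS.
  move=> j_neq1 j_norm.
  have [k|s [s_order s_last]] := frequency_order_exists n_gt2 j_neq1.
    by rewrite j_norm.
  by exists s; split => //; rewrite /last_eigenspace s_last submx_refl.
have card_j j : (0 < j < m)%N -> coprime j m ->
    minimal_designs_have_card R n j (if odd j then n - 2 else n - 4)%N.
  move=> j_bnd co_jm s [_ sE _ _] /(last_eigenspace_Lambda n_gt2) s_last W W_min.
  have sin_j : sinn R n j != 0 by rewrite nE; apply: sinn_neq0.
  have card_W g := card_minimal_design (g := g) n_gt2 sE s_last sin_j ^~ W_min.
  case: ifP => j_odd.
    rewrite (card_W 1%N) // => u; apply: card_fiber_coprime => //.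
    by rewrite nE coprimeMr co_jm coprimen2 j_odd.
  rewrite (card_W 2%N) // => u.
  by apply: card_fiber_even nE _ co_jm; rewrite ?j_odd.
have co1 : coprime j1 m.
  by have := coprimeSn (2 * j1); rewrite -addn1 -mE1 coprimeMr => /andP[_]; rewrite coprime_sym.
have co2 : coprime j2 m.
  by have := coprimenS m; rewrite -addn1 mE2 coprimeMr => /andP[_]; rewrite coprime_sym.
split.
- apply: exists_order; last by rewrite gtr0_norm.
  rewrite nE cosn_eq1; last by lia.
  by rewrite gtnNdvd; lia.
- apply: exists_order; last by rewrite cos_j2 normrN gtr0_norm.
  by rewrite cos_j2 lt_eqF //; lra.
- move=> s s_order; have [last_in last_min] := frequency_order_last n_gt2 j1 s_order.
  have [_ sE _ _] := s_order.
  have := last_in; rewrite sE (eigenvalue_cycle_op n_gt2) => /existsP[k /eqP s_last].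
  have : `|last 0 s| = `|cosn R n j1|.
    by apply/le_anti; rewrite last_min -s_last (gtr0_norm cos_j1_gt0) cos_j1_min.
  move/eqP; rewrite eqr_norm2 -cos_j2 /last_eigenspace => /orP[]/eqP ->; [left|right];
    by rewrite submx_refl.
have := card_j j1; have := card_j j2.
have -> : odd j2 = ~~ odd j1 by lia.
case: (odd j1) => /= card2 card1; [right|left]; split.
all: by [apply: card1; lia | apply: card2; lia].
Qed.
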